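(* Let $\Omega\subset\mathbb{R}^n$ be a Borel set and let $F\subset\overline{\Omega}$ be closed with $\mathcal{L}^n(F\cap\Omega)=0$. Then for every density measure $\mu\in\mathrm{Dens}(F)$ $$\operatorname{core}\mu\subset F$$ and $\mu$ is pure.
   Context: $\mathcal{B}(\Omega)$ is the Borel $\sigma$-algebra of $\Omega$ and $\mathcal{L}^n$ is Lebesgue measure. A measure is a finitely additive real-valued set function; a $\sigma$-measure is a countably additive one. $\mathrm{ba}(\Omega,\mathcal{B}(\Omega))$ is the vector lattice (with setwise order) of bounded measures on $\mathcal{B}(\Omega)$, $|\mu|$ is the total variation, and $(\mu\wedge\nu)(A)=\inf\{\mu(A')+\nu(A\setminus A'):A'\in\mathcal{B}(\Omega),A'\subset A\}$. $\mathrm{ba}(\Omega,\mathcal{B}(\Omega),\mathcal{L}^n)$ is the set of $\mu\in\mathrm{ba}(\Omega,\mathcal{B}(\Omega))$ such that $\mathcal{L}^n(B)=0$ implies $\mu(B)=0$ for all $B\in\mathcal{B}(\Omega)$. $\mu$ is pure if $|\mu|\wedge|\nu|=0$ for all bounded $\sigma$-measures $\nu$ on $\mathcal{B}(\Omega)$. The core of $\mu$ is $\operatorname{core}\mu:=\{x\in\mathbb{R}^n:|\mu|(V\cap\Omega)>0\text{ for all open }V\subset\mathbb{R}^n\text{ with }x\in V\}$. $F_\delta$ denotes the open $\delta$-neighbourhood of $F$ in $\mathbb{R}^n$. For closed $F\subset\overline\Omega$ with $\mathcal{L}^n(F\cap\Omega)=0$, a density measure for $F$ is a $\mu\in\mathrm{ba}(\Omega,\mathcal{B}(\Omega),\mathcal{L}^n)$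 with $\mu\geq0$ and $\mu(F_\delta\cap\Omega)=\mu(\Omega)=1$ for all $\delta>0$. $\mathrm{Dens}(F)$ is the set of all density measures for $F$. *)

(* Defs.v *)
From HB Require Import structures.
From mathcomp Require Import all_boot all_order all_algebra.
From mathcomp Require Import all_classical all_reals all_analysis.

Set Implicit Arguments.
Unset Strict Implicit.
Unset Printing Implicit Defensive.

Import Order.TTheory GRing.Theory Num.Theory.
Import numFieldNormedType.Exports.

Local Open Scope classical_set_scope.
Local Open Scope ring_scope.

(* The n-fold product of the Lebesgue measure on R, sections being integrated
   as in [product_measure1]. On Borel sets this is the Lebesgue measure L^n (see
   [lebesgue_rV_box]); its values on other sets are irrelevant. *)
Fixpoint lebesgue_rV (R : realType) (n : nat) : set 'rV[R]_n -> \bar R :=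
  match n return set 'rV[R]_n -> \bar R with
  | 0 => fun A => (\1_A (0 : 'rV[R]_0))%:E
  | m.+1 => fun A =>
      (\int[@lebesgue_measure R]_(t in setT)
        lebesgue_rV [set v : 'rV[R]_m | A (row_mx (t%:M : 'rV[R]_1) v)])%E
  end.

Lemma lebesgue_rV_box (R : realType) (n : nat) (a b : 'rV[R]_n) :
  (forall i, a ord0 i <= b ord0 i) ->
  lebesgue_rV [set v : 'rV[R]_n | forall i, v ord0 i \in `]a ord0 i, b ord0 i]] =
  (\prod_i (b ord0 i - a ord0 i))%:E.
Proof.
elim: n a b => [|n IH] a b leab /=.
  by rewrite big_ord0 indicE mem_set//= => -[].
pose a' : 'rV[R]_n := \row_j a ord0 (lift ord0 j).
pose b' : 'rV[R]_n := \row_j b ord0 (lift ord0 j).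
pose c := \prod_i (b' ord0 i - a' ord0 i).
have row0 (t : R) (v : 'rV[R]_n) :
    (row_mx (t%:M : 'rV[R]_1) v : 'rV[R]_n.+1) ord0 ord0 = t.
  have -> : (ord0 : 'I_n.+1) = lshift n (ord0 : 'I_1) by exact: val_inj.
  by rewrite (row_mxEl (t%:M : 'rV[R]_1) v) mxE eqxx mulr1n.
have rowS (t : R) (v : 'rV[R]_n) (j : 'I_n) :
    (row_mx (t%:M : 'rV[R]_1) v : 'rV[R]_n.+1) ord0 (lift ord0 j) = v ord0 j.
  have -> : lift ord0 j = rshift 1 j :> 'I_(1 + n) by exact: val_inj.
  by rewrite (row_mxEr (t%:M : 'rV[R]_1) v).
have le0 : lebesgue_rV (set0 : set 'rV[R]_n) = 0%E.
  elim: (n) => [|m IHm] /=; first by rewrite indic0.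
  by under eq_integral do rewrite IHm; rewrite integral0.
transitivity (\int[@lebesgue_measure R]_(t in setT)
    (c%:E * (\1_`]a ord0 ord0, b ord0 ord0] t)%:E))%E; last first.
  rewrite integralZl//; last first.
    exact: integrable_indic_itv.
  rewrite integral_indic// setIT [X in (_ * X)%E](_ : _ = lebesgue_measure `]a ord0 ord0, b ord0 ord0]%classic)//.
  rewrite lebesgue_measure_itv/= lte_fin big_ord_recl.
  have -> : \prod_(i < n) (b ord0 (lift ord0 i) - a ord0 (lift ord0 i)) = c.
    by apply: eq_bigr => j _; rewrite !mxE.
  have := leab ord0; rewrite le_eqVlt => /predU1P[->|ab].
    by rewrite ltxx mule0 subrr mul0r.
  by rewrite ab -EFinB -EFinM mulrC.
apply: eq_integral => t _; rewrite indicE; case: (boolP (t \in _)) => ht.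
  rewrite mule1 -IH; last by move=> j; rewrite !mxE.
  congr lebesgue_rV; apply/seteqP; split => v /= hv i.
    by have := hv (lift ord0 i); rewrite rowS !mxE.
  case: (unliftP ord0 i) => [j|] ->; last by rewrite row0; rewrite inE in ht.
  by have := hv j; rewrite rowS !mxE.
rewrite mule0 -[RHS]le0; congr lebesgue_rV; apply/seteqP; split => v //= hv.
by move: ht; rewrite notin_setE /=; apply; have := hv ord0; rewrite row0.
Qed.

Section borel.
Context (R : realType) (n : nat).
Implicit Type Omega : set 'rV[R]_n.

(* The Borel sigma-algebra of the subspace Omega of R^n. *)
Definition borel Omega : set (set 'rV[R]_n) :=
  <<s Omega, [set V `&` Omega | V in open] >>.

Lemma borel_sub Omega A : borel Omega A -> A `<=` Omega.
Proof.
apply: (@smallest_sub _ _ _ [set B | B `<=` Omega]) => [|_ [V _ <-]].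
  split=> [|B _|B]; [exact: sub0set|exact: subDsetl|].
  by move=> BO; apply: bigcup_sub => i _; exact: BO.
exact: subIsetr.
Qed.

Lemma borel_sigma_algebra Omega : sigma_algebra Omega (borel Omega).
Proof. exact: smallest_sigma_algebra. Qed.

Lemma borel0 Omega : borel Omega set0.
Proof. by have [] := borel_sigma_algebra Omega. Qed.

Lemma borel_bigcup Omega : forall F : (set 'rV[R]_n)^nat,
  (forall i, borel Omega (F i)) -> borel Omega (\bigcup_i F i).
Proof. by have [] := borel_sigma_algebra Omega. Qed.

Lemma borelD Omega : setD_closed (borel Omega).
Proof.
move=> A B bA bB; have [_ bC bU] := borel_sigma_algebra Omega.
have -> : A `\` B = Omega `\` \bigcup_i (bigcup2 (Omega `\` A) B) i.
  rewrite bigcup2E setDUr setDD (setIidr (borel_sub bA)) setIDA.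
  by rewrite (setIidl (borel_sub bA)).
apply: (bC); apply: bU => -[|[|i]] /=; [exact: bC|exact: bB|exact: borel0].
Qed.

End borel.

Definition borel_display (R : realType) (n : nat) (Omega : set 'rV[R]_n) :
  measure_display.
Proof. exact: default_measure_display. Qed.

(* An alias of R^n whose measurable sets are the Borel subsets of Omega. They
   form a sigma-ring on R^n (with unit Omega), so that the charges of the
   library are set functions on [borel Omega]; the values of a charge outside
   of [borel Omega] are irrelevant. *)
Definition borelType (R : realType) (n : nat) (Omega : set 'rV[R]_n) : Type :=
  'rV[R]_n.

HB.instance Definition _ (R : realType) (n : nat) (Omega : set 'rV[R]_n) :=
  Pointed.on (borelType Omega).
HB.instance Definition _ (R : realType) (n : nat) (Omega : set 'rV[R]_n) :=
  @isSigmaRing.Build (borel_display Omega) (borelType Omega) (borel Omega)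
    (@borel0 R n Omega) (@borelD R n Omega) (@borel_bigcup R n Omega).

Section set_functions.
Context d (T : sigmaRingType d) (R : realType).
Implicit Types mu nu : set T -> \bar R.
Local Open Scope ereal_scope.

Definition bounded_set_fun mu : Prop :=
  exists M : R, forall A, measurable A -> `|mu A| <= M%:E.

Definition nonneg_set_fun mu : Prop := forall A, measurable A -> 0 <= mu A.

(* The supremum over all finite measurable partitions of A. *)
Definition tvar mu (A : set T) : \bar R :=
  ereal_sup [set s | exists (F : (set T)^nat) (m : nat),
    [/\ forall i, measurable (F i), trivIset setT F,
        \big[setU/set0]_(i < m) F i = A & s = \sum_(i < m) `|mu (F i)|]].

Definition meet_set_fun mu nu (A : set T) : \bar R :=
  ereal_inf [set mu B + nu (A `\` B) | B in [set B | measurable B /\ B `<=` A]].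

Definition pure (mu : {additive_charge set T -> \bar R}) : Prop :=
  forall nu : {charge set T -> \bar R}, bounded_set_fun nu ->
  forall A, measurable A -> meet_set_fun (tvar mu) (tvar nu) A = 0.

End set_functions.

Section density.
Context (R : realType) (n : nat).
Implicit Types Omega F : set 'rV[R]_n.

Definition core Omega (mu : {additive_charge set (borelType Omega) -> \bar R}) :
    set 'rV[R]_n :=
  [set x | forall V : set 'rV[R]_n, open V -> V x ->
             (0 < tvar mu (V `&` Omega))%E].

(* The norm of the library on 'rV[R]_n is the maximum norm. *)
Definition enorm (v : 'rV[R]_n) : R := Num.sqrt (\sum_i v ord0 i ^+ 2).

Definition nbhd F (delta : R) : set 'rV[R]_n :=
  [set x | exists2 y, F y & enorm (x - y) < delta].

(* Membership in ba(Omega, B(Omega), L^n). *)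
Definition in_ba_leb Omega
    (mu : {additive_charge set (borelType Omega) -> \bar R}) : Prop :=
  bounded_set_fun mu /\
  forall B : set 'rV[R]_n, borel Omega B ->
    lebesgue_rV B = 0%E -> mu B = 0%E.

Definition Dens Omega F :
    set ({additive_charge set (borelType Omega) -> \bar R}) :=
  [set mu | [/\ in_ba_leb mu, nonneg_set_fun mu &
     forall delta : R, 0 < delta ->
       mu (nbhd F delta `&` Omega) = mu Omega /\ mu Omega = 1%E]].

End density.

(* Main.v *)
(* As mu >= 0, the total variation of mu is mu itself, and mu vanishes off every
   neighbourhood F_delta. A point outside of the closed set F has an open
   neighbourhood missing some F_delta, so it is not in the core. For purity, the
   sets D_k := A `&` (F_(1/k) `\` F) decrease to the empty set because F is
   closed, whereas mu (A `\` D_k) = 0 because F is L^n-null in Omega. For a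
   bounded sigma-measure nu, |nu| is continuous from above at the empty set, so
   |mu| (A `\` D_k) + |nu| (D_k) is arbitrarily small. *)

Require Import Defs.
From HB Require Import structures.
From mathcomp Require Import all_boot all_order all_algebra.
From mathcomp Require Import all_classical all_reals all_analysis.
From mathcomp Require Import lra.

Set Implicit Arguments.
Unset Strict Implicit.
Unset Printing Implicit Defensive.

Import Order.TTheory GRing.Theory Num.Theory.
Import numFieldNormedType.Exports.

Local Open Scope classical_set_scope.
Local Open Scope ring_scope.

(** * Total variation of finitely and countably additive charges *)

Section tvar_theory.
Context d (T : sigmaRingType d) (R : realType).
Local Open Scope ereal_scope.

Lemma tvar_ubound (mu : set T -> \bar R) (F : (set T)^nat) (m : nat) :
  (forall i, measurable (F i)) -> trivIset setT F ->
  \sum_(i < m) `|mu (F i)| <= tvar mu (\big[setU/set0]_(i < m) F i).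
Proof. by move=> mF tF; apply: ereal_sup_ubound; exists F, m; split. Qed.

Lemma tvar_ge_abs (mu : set T -> \bar R) (A : set T) :
  measurable A -> `|mu A| <= tvar mu A.
Proof.
move=> mA; have := @tvar_ubound mu (bigcup2 A set0) 1%N.
rewrite !big_ord_recl !big_ord0 /= setU0 adde0; apply.
- by move=> [|[|i]] /=.
- by rewrite -trivIset_bigcup2 setI0.
Qed.

Lemma tvar_ge0 (mu : set T -> \bar R) (A : set T) :
  measurable A -> 0 <= tvar mu A.
Proof. by move=> mA; apply: le_trans (tvar_ge_abs mu mA). Qed.

Lemma additive_charge0 (mu : {additive_charge set T -> \bar R}) : mu set0 = 0.
Proof.
have /[!big_ord0] ->// := @charge_semi_additive _ _ _ mu (fun=> set0) 0%N.
exact: trivIset_set0.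
Qed.

Lemma additive_chargeU (mu : {additive_charge set T -> \bar R}) :
  additive2 mu.
Proof.
move=> A B mA mB AB0.
apply: (semi_additiveW (additive_charge0 mu)) => //; exact: measurableU.
Qed.

Section nonneg.
Variables (mu : {additive_charge set T -> \bar R}) (mu_ge0 : nonneg_set_fun mu).

Lemma nonneg_charge_le (A B : set T) :
  measurable A -> measurable B -> A `<=` B -> mu A <= mu B.
Proof.
move=> mA mB AB; have mBA : measurable (B `\` A) by exact: measurableD.
rewrite -(setDUK AB) additive_chargeU ?setDIK//.
by rewrite leeDl// mu_ge0.
Qed.

(** The absolute values drop out, so finite additivity makes every partition sum equal to [mu A]. *)
Lemma nonneg_tvarE (A : set T) : measurable A -> tvar mu A = mu A.
Proof.
move=> mA; apply/le_anti/andP; split; last first.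
  by rewrite (le_trans _ (tvar_ge_abs mu mA))// lee_abs.
apply: ge_ereal_sup => _ [F [m [mF tF FA ->]]].
rewrite -FA charge_semi_additive//; last by rewrite FA.
by under eq_bigr do rewrite gee0_abs ?mu_ge0//.
Qed.

End nonneg.

(** Split a partition by the sign of [nu] on its pieces: up to sign, each of the two sums is the
    value of [nu] on a union of pieces, hence at most [M]. So every partition sum is at most
    [M + M]. *)
Lemma tvar_fin_num (nu : {additive_charge set T -> \bar R}) (A : set T) :
  bounded_set_fun nu -> measurable A -> tvar nu A \is a fin_num.
Proof.
move=> [M nuM] mA.
rewrite ge0_fin_numE ?tvar_ge0//.
apply: (@le_lt_trans _ _ (M + M)%:E); last exact: ltry.
apply: ge_ereal_sup => _ [F [m [mF tF FA ->]]].
have part (P : pred nat) :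
    `|\sum_(i < m | P i) nu (F i)| <= M%:E.
  (* Emptying the pieces not selected by [P] keeps the indexing and turns the sum into a single
     value of [nu]. *)
  pose G i := if P i then F i else set0.
  have mG i : measurable (G i) by rewrite /G; case: ifP.
  have -> : \sum_(i < m | P i) nu (F i) = nu (\big[setU/set0]_(i < m) G i).
    rewrite charge_semi_additive//; first last.
    - exact: bigsetU_measurable.
    - apply/trivIsetP => i j _ _ ij; rewrite /G.
      case: ifP => _; last by rewrite set0I.
      case: ifP => _; last by rewrite setI0.
      by move/trivIsetP : tF; apply.
    rewrite big_mkcond /=; apply: eq_bigr => i _; rewrite /G.
    by case: ifP; rewrite ?additive_charge0.
  by apply: nuM; exact: bigsetU_measurable.
rewrite (bigID (fun i : 'I_m => 0 <= nu (F i))) /= EFinD; apply: leeD.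
- rewrite (le_trans _ (part (fun i => 0 <= nu (F i))))//.
  rewrite gee0_abs ?sume_ge0//.
  by rewrite le_eqVlt; apply/orP; left; apply/eqP/eq_bigr => i /gee0_abs.
- rewrite (le_trans _ (part (fun i => ~~ (0 <= nu (F i)))))//.
  have le0 i : ~~ (0 <= nu (F i)) -> nu (F i) <= 0 by rewrite -ltNge => /ltW.
  rewrite lee0_abs; last by apply: sume_le0 => i; exact: le0.
  rewrite -sumeN; last first.
    by move=> i j _ _; rewrite fin_num_adde_defl// fin_num_measure.
  rewrite le_eqVlt; apply/orP; left; apply/eqP/eq_bigr => i /le0.
  exact: lee0_abs.
Qed.

(** A partition of [B] appended to the pieces [F i] partitions the union. The pieces [F i] stay
    fixed while the supremum is taken over the partitions of [B]; their sum is finite and can be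
    moved across the inequality. *)
Lemma tvar_superadditive (nu : {additive_charge set T -> \bar R})
    (F : (set T)^nat) (m : nat) (B : set T) :
  (forall i, measurable (F i)) -> trivIset setT F ->
  (\big[setU/set0]_(i < m) F i) `&` B = set0 ->
  \sum_(i < m) `|nu (F i)| + tvar nu B <=
  tvar nu (\big[setU/set0]_(i < m) F i `|` B).
Proof.
move=> mF tF FB0.
have fin_s : \sum_(i < m) `|nu (F i)| \is a fin_num.
  by apply/sum_fin_numP => i _ _; rewrite abse_fin_num fin_num_measure.
rewrite addeC -leeBrDr//; apply: ge_ereal_sup => _ [G [p [mG tG GB ->]]].
rewrite leeBrDr// addeC.
(* The concatenation is cut off at [m + p]: only the first [p] sets of [G] lie in [B] and are thus
   known to be disjoint from the first [m] sets of [F]. *)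
pose H i := if (i < m)%N then F i else if (i < m + p)%N then G (i - m)%N else set0.
have Hl (i : 'I_m) : H (lshift p i) = F i by rewrite /H /= ltn_ord.
have Hr (i : 'I_p) : H (rshift m i) = G i.
  by rewrite /H /= ltnNge leq_addr /= ltn_add2l ltn_ord addKn.
have mH i : measurable (H i) by rewrite /H; case: ifP => // _; case: ifP.
have FG i j : (i < m)%N -> (j < p)%N -> F i `&` G j = set0.
  move=> im jp; rewrite -subset0 -FB0 -GB; apply: setISS.
  - exact: bigsetU_sup.
  - exact: bigsetU_sup.
have tH : trivIset setT H.
  apply/trivIsetP => i j _ _ ij; rewrite /H.
  move/trivIsetP in tF; move/trivIsetP in tG.
  case: (ltnP i m) => im; case: (ltnP j m) => jm; first exact: tF.
  - case: ifP => jp; last by rewrite setI0.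
    by rewrite FG// ltn_subLR.
  - case: ifP => ip; last by rewrite set0I.
    by rewrite setIC FG// ltn_subLR.
  - case: ifP => _; last by rewrite set0I.
    case: ifP => _; last by rewrite setI0.
    apply: tG => //; apply: contra ij => /eqP e.
    by rewrite -(subnK im) -(subnK jm) e.
have := @tvar_ubound nu H (m + p) mH tH.
rewrite !big_split_ord /=.
under eq_bigr do rewrite Hl.
under [X in _ + X <= _]eq_bigr do rewrite Hr.
under [X in tvar nu (X `|` _)]eq_bigr do rewrite Hl.
under [X in tvar nu (_ `|` X)]eq_bigr do rewrite Hr.
by rewrite GB.
Qed.

(** The complements [E k] of [D k] in [D 0] increase to [D 0]; countable additivity over their
    successive differences gives the limit of [nu (E k)], and finiteness allows subtraction. *)
Lemma charge_cvg_set0 (nu : {charge set T -> \bar R}) (D : (set T)^nat) :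
  (forall k, measurable (D k)) -> {homo D : i j / (i <= j)%N >-> j `<=` i} ->
  \bigcap_k D k = set0 -> nu (D k) @[k --> \oo] --> 0.
Proof.
move=> mD ndD D0; pose E k := D 0%N `\` D k.
have mE k : measurable (E k) by exact: measurableD.
have ndE : nondecreasing_seq E.
  by move=> i j ij; apply/subsetPset; apply: setDS; apply: ndD; exact: ij.
have bigE : \bigcup_k E k = D 0%N.
  under eq_bigcupr do rewrite /E setDE.
  by rewrite -setI_bigcupr -setC_bigcap D0 setC0 setIT.
have mSE k : measurable (seqD E k) by case: k => [|k] /=; [|exact: measurableD].
have nuD k : nu (D k) = nu (D 0%N) - nu (E k).
  have Dk0 : D k `<=` D 0%N by exact: ndD.
  rewrite chargeD// (setIidr Dk0) fin_num_oppeB ?fin_num_measure//.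
  by rewrite addeA subee ?add0e// fin_num_measure.
have cvgE : nu (E k) @[k --> \oo] --> nu (D 0%N).
  have := @charge_semi_sigma_additive _ _ _ nu (seqD E) mSE (trivIset_seqD ndE).
  (* [E k] is the union of the first [k + 1] differences, hence the shift of the index. *)
  rewrite eq_bigcup_seqD bigE -cvg_shiftS => /(_ (mD 0%N)).
  apply: cvg_trans; apply: near_eq_cvg; apply: nearW => k /=.
  rewrite big_mkord -(nondecreasing_bigsetU_seqD k ndE).
  rewrite charge_semi_additive//; first exact: trivIset_seqD.
  exact: bigsetU_measurable.
under eq_cvg do rewrite nuD.
rewrite -[0](@subee _ (nu (D 0%N))) ?fin_num_measure//.
apply: cvgeB => //; last exact: cvg_cst.
by rewrite fin_num_adde_defr// fin_num_measure.
Qed.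

(* For a partition (F_i) of D_0 nearly attaining |nu| (D_0), the sums of the
   |nu (F_i \ D_k)| tend to the sum of the |nu F_i|, and by superadditivity
   |nu| (D_k) <= |nu| (D_0) - \sum_i |nu (F_i \ D_k)|. *)
Lemma tvar_cvg_set0 (nu : {charge set T -> \bar R}) (D : (set T)^nat) :
  bounded_set_fun nu ->
  (forall k, measurable (D k)) -> {homo D : i j / (i <= j)%N >-> j `<=` i} ->
  \bigcap_k D k = set0 ->
  forall e : R, (0 < e)%R -> exists k, tvar nu (D k) <= e%:E.
Proof.
move=> nu_bnd mD ndD D0 e e0.
have finD0 := tvar_fin_num nu_bnd (mD 0%N).
have [_ [F [m [mF tF FD0 ->]]]] := ub_ereal_sup_adherent e0 finD0.
rewrite -/(tvar nu (D 0%N)) => ltF.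
have cvgF : \sum_(i < m) `|nu (F i `\` D k)| @[k --> \oo] -->
    \sum_(i < m) `|nu (F i)|.
  apply: cvg_nnesum => i _; first by apply: nearW => k.
  apply: cvg_abse.
  (* The part removed from [F i] is its intersection with [D k], and these intersections again
     decrease to the empty set. *)
  under eq_cvg do rewrite chargeD//.
  have := @cvgeB _ _ _ _ (cst (nu (F i))) (fun k => nu (F i `&` D k)) (nu (F i)) 0.
  rewrite sube0; apply; last 2 first; first exact: cvg_cst.
  apply: charge_cvg_set0.
  - by move=> k; exact: measurableI.
  - by move=> a b ab; apply: setIS; exact: ndD.
  - by rewrite -subset0 -D0 => x FDx k _; have [] := FDx k Logic.I.
  by rewrite oppe0 adde_defC fin_num_adde_defr.
have [k _ /(_ k (leqnn k)) /= ltFk] := cvgF _ (open_ereal_gt' ltF).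
exists k.
have Dk0 : D k `<=` D 0%N by exact: ndD.
have := @tvar_superadditive nu (fun i => F i `\` D k) m (D k).
have -> : \big[setU/set0]_(i < m) (F i `\` D k) = D 0%N `\` D k.
  by rewrite -FD0 -(bigcup_mkord m F) setD_bigcupl bigcup_mkord.
rewrite setDKI setDKU// => sup.
have {}sup : \sum_(i < m) `|nu (F i `\` D k)| + tvar nu (D k) <= tvar nu (D 0%N).
  apply: sup => // [i|]; first exact: measurableD.
  exact: trivIset_setIr.
have finDk := tvar_fin_num nu_bnd (mD k).
have finS : \sum_(i < m) `|nu (F i `\` D k)| \is a fin_num.
  apply/sum_fin_numP => i _ _; rewrite abse_fin_num fin_num_measure//.
  exact: measurableD.
move: sup ltFk; rewrite -(fineK finD0) -(fineK finDk) -(fineK finS).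
rewrite -EFinD -EFinB !lee_fin lte_fin; lra.
Qed.
End tvar_theory.

(** * Euclidean neighbourhoods in the max-norm topology *)

Section neighbourhoods.
Context (R : realType) (n : nat).
Implicit Types F Omega : set 'rV[R]_n.

Lemma enorm0 : enorm (0 : 'rV[R]_n) = 0.
Proof. by rewrite /enorm big1 ?sqrtr0// => i _; rewrite mxE expr0n. Qed.

Lemma normr_coord_le_enorm (v : 'rV[R]_n) i : `|v ord0 i| <= enorm v.
Proof.
rewrite -sqrtr_sqr /enorm ler_sqrt ?sumr_ge0// => [|j _]; last exact: sqr_ge0.
by rewrite (bigD1 i)//= lerDl sumr_ge0// => j _; exact: sqr_ge0.
Qed.

Lemma enormB_continuous (y : 'rV[R]_n) : continuous (fun x : 'rV[R]_n => enorm (x - y)).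
Proof.
move=> v; apply: (@continuous_comp _ _ _
    (fun x : 'rV[R]_n => \sum_i (x - y) ord0 i ^+ 2)); last first.
  exact: sqrt_continuous.
apply: continuous_big => [|i _]; first exact: add_continuous.
move=> w; apply: (@continuous_comp _ _ _
    (fun x : 'rV[R]_n => (x - y) ord0 i) (fun r : R => r ^+ 2)); last first.
  exact: exprn_continuous.
rewrite (_ : (fun x : 'rV[R]_n => _) = (fun x => x ord0 i - y ord0 i)).
  have cf : continuous (fun x : 'rV[R]_n => x ord0 i) by exact: coord_continuous.
  exact: (cvgB (cf w) (cvg_cst _)).
by apply/funext => x; rewrite !mxE.
Qed.

Lemma open_nbhd F (e : R) : open (nbhd F e).
Proof.
have -> : nbhd F e = \bigcup_(y in F) ((fun x => enorm (x - y)) @^-1` [set r | r < e]).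
  by apply/seteqP; split=> x [y Fy xy]; exists y.
apply: bigcup_open => y _; apply: open_comp; last exact: open_lt.
by move=> x _; exact: enormB_continuous.
Qed.

Lemma subset_nbhd F (e : R) : 0 < e -> F `<=` nbhd F e.
Proof. by move=> e0 x Fx; exists x => //; rewrite subrr enorm0. Qed.

Lemma nbhdS F (d e : R) : d <= e -> nbhd F d `<=` nbhd F e.
Proof. by move=> de x [y Fy xy]; exists y => //; exact: lt_le_trans de. Qed.

(** Halve the radius of a max-norm ball around [x] that misses [F] and apply the triangle inequality
    in each coordinate; the Euclidean distance in [nbhd] dominates every coordinate difference. *)
Lemma closed_notin_nbhd F (x : 'rV[R]_n) : closed F -> ~ F x ->
  exists2 e : R, 0 < e & ball x e `&` nbhd F e = set0.
Proof.
move=> cF Fx.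
have : nbhs x (~` F) by apply: open_nbhs_nbhs; split => //; exact: closed_openC.
move=> /nbhs_ballP[e /= e0 xF].
have e20 : 0 < e / 2 by rewrite divr_gt0.
exists (e / 2) => //; apply/seteqP; split=> // z [[_ xz] [y Fy zy]].
apply: (xF y) Fy; split=> // i j.
rewrite [e]splitr; apply: ball_triangle (xz i j) _.
rewrite ord1 -ball_normE /ball_ /=; apply: le_lt_trans zy.
by have := normr_coord_le_enorm (z - y) j; rewrite !mxE.
Qed.

End neighbourhoods.

(** * Core and purity of density measures *)

Section density_measures.
Context (R : realType) (n : nat) (Omega F : set 'rV[R]_n).
Implicit Type mu : {additive_charge set (borelType Omega) -> \bar R}.

Lemma borel_open (V : set 'rV[R]_n) : open V -> borel Omega (V `&` Omega).
Proof. by move=> oV; apply: sub_gen_smallest; exists V. Qed.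

Lemma borelT : borel Omega Omega.
Proof. by have := borel_open (@openT 'rV[R]_n); rewrite setTI. Qed.

Lemma borel_closed (C : set 'rV[R]_n) : closed C -> borel Omega (C `&` Omega).
Proof.
move=> cC; rewrite (_ : C `&` Omega = Omega `\` (~` C `&` Omega)).
  by apply: borelD; [exact: borelT|apply: borel_open; exact: closed_openC].
by rewrite setDIr setDv setU0 setDE setCK setIC.
Qed.

Lemma borel_nbhd (e : R) : borel Omega (nbhd F e `&` Omega).
Proof. by apply: borel_open; exact: open_nbhd. Qed.

Lemma borel_setD_nbhd (e : R) : borel Omega (Omega `\` nbhd F e).
Proof.
have -> : Omega `\` nbhd F e = Omega `\` (nbhd F e `&` Omega).
  by rewrite setDIr setDv setU0.
by apply: borelD; [exact: borelT|exact: borel_nbhd].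
Qed.

(** The neighbourhood already carries the whole mass 1, so additivity leaves nothing for its
    complement. *)
Lemma Dens_setD_nbhd mu (e : R) : Dens F mu -> 0 < e ->
  mu (Omega `\` nbhd F e) = 0%E.
Proof.
move=> [_ _ muF] e0; have [muFe mu1] := muF _ e0.
have mFe := borel_nbhd e; have mC := borel_setD_nbhd e.
have : mu Omega = (mu (nbhd F e `&` Omega) + mu (Omega `\` nbhd F e))%E.
  rewrite -additive_chargeU//.
    by rewrite [X in X `|` _]setIC setUIDK.
  by rewrite -subset0 => x [[Nx _] [_]]; exact.
rewrite muFe mu1 -(@fineK _ (mu (Omega `\` _))) ?fin_num_measure// -EFinD.
by move=> [h]; congr EFin; lra.
Qed.

Lemma core_Dens mu : closed F -> Dens F mu -> core mu `<=` F.
Proof.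
move=> cF muD x corex; apply: contrapT => Fx.
have [e e0 eF] := closed_notin_nbhd cF Fx.
have [_ mu0 _] := muD.
(* The core is tested on open sets, so the interior of the ball is used. *)
have mV : borel Omega ((ball x e)° `&` Omega).
  by apply: borel_open; exact: open_interior.
have : (0 < tvar mu ((ball x e)° `&` Omega))%E.
  apply: corex; first exact: open_interior.
  exact: nbhsx_ballx.
rewrite (nonneg_tvarE mu0 mV); apply/negP; rewrite -leNgt.
rewrite -(Dens_setD_nbhd muD e0); apply: nonneg_charge_le => //; first exact: borel_setD_nbhd.
move=> y [/interior_subset ye Oy]; split=> // Fy.
by have : (ball x e `&` nbhd F e) y by []; rewrite eF.
Qed.

Lemma pure_Dens mu : closed F -> lebesgue_rV (F `&` Omega) = 0%E ->
  Dens F mu -> pure mu.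
Proof.
move=> cF F0 muD nu nu_bnd A mA.
have [[mu_bnd muL] mu0 _] := muD.
pose N k := nbhd F k.+1%:R^-1.
pose D k := A `&` (N k `\` F).
have AO : A `<=` Omega := borel_sub mA.
have mN k : borel Omega (N k `&` Omega) := borel_nbhd _.
have mF : borel Omega (F `&` Omega) by exact: borel_closed.
have mD k : borel Omega (D k).
  (* Rewritten with traces on [Omega], since [borel Omega] contains only subsets of [Omega]. *)
  have -> : D k = (A `&` (N k `&` Omega)) `\` (F `&` Omega).
    apply/seteqP; split=> x.
      by move=> [Ax [Nx Fx]]; split=> [|[]//]; do !split=> //; exact: AO.
    by move=> [[Ax [Nx Ox]] nFO]; split=> //; split=> // Fx; exact: nFO.
  by apply: borelD => //; exact: (measurableI _ _ mA (mN k)).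
have ndD : {homo D : i j / (i <= j)%N >-> j `<=` i}.
  move=> i j ij; apply: setIS; apply: setSD; apply: nbhdS.
  by rewrite lef_pV2 ?posrE// ler_nat.
have D0 : \bigcap_k D k = set0.
  rewrite -subset0 => x Dx; have [_ [_ Fx]] := Dx 0%N Logic.I.
  have [e e0 eF] := closed_notin_nbhd cF Fx.
  (* Once [1 / (k + 1) < e], membership of [x] in [N k] contradicts the choice of [e]. *)
  have [k _ /(_ k (leqnn k)) /= ke] := near_infty_natSinv_lt (PosNum e0).
  suff : (ball x e `&` nbhd F e) x by rewrite eF.
  split; first exact: ballxx.
  by have [_ [Nx _]] := Dx k Logic.I; apply: nbhdS Nx; exact: ltW.
have mAD k : borel Omega (A `\` D k) by exact: borelD.
have mu_AD k : tvar mu (A `\` D k) = 0%E.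
  rewrite (nonneg_tvarE mu0 (mAD k)); apply/le_anti/andP; split; last exact: mu0 (mAD k).
  have mO := borelD borelT (mN k).
  (* This set contains [A] minus [D k]. Its two parts are disjoint as [F] lies in [N k]; the first
     is null by absolute continuity, the second because it misses a neighbourhood of [F]. *)
  have -> : 0%E = mu ((F `&` Omega) `|` (Omega `\` (N k `&` Omega))).
    rewrite additive_chargeU//.
      rewrite muL// setDIr setDv setU0 Dens_setD_nbhd// ?adde0// invr_gt0//.
    rewrite -subset0 => x [[Fx Ox] [_]]; apply; split=> //.
    by apply: subset_nbhd Fx; rewrite invr_gt0.
  apply: (nonneg_charge_le mu0 (mAD k) (@measurableU _ (borelType Omega) _ _ mF mO)).
  move=> x [Ax nDx]; have [Fx|Fx] := pselect (F x); first by left; split=> //; exact: AO.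
  by right; split=> [|[Nx _]]; [exact: AO|exact: nDx].
apply/le_anti/andP; split; last first.
  apply: le_ereal_inf_tmp => _ [B [mB BA] <-].
  by rewrite adde_ge0// tvar_ge0//; exact: borelD.
apply/lee_addgt0Pr => e e0; rewrite add0e.
have [k nuD] := tvar_cvg_set0 nu_bnd mD ndD D0 e0.
(* Testing the infimum with [A] minus [D k] leaves [D k] to the variation of [nu]. *)
apply: le_trans nuD; apply: ereal_inf_lbound; exists (A `\` D k).
  by split; [exact: mAD|exact: subDsetl].
by rewrite mu_AD add0e setDD /D setIA setIid.
Qed.

End density_measures.

Theorem proposition5p5 (R : realType) (n : nat) (Omega F : set 'rV[R]_n)
    (Omega_borel : borel setT Omega) (F_closed : closed F)
    (F_sub : F `<=` closure Omega)
    (F_null : lebesgue_rV (F `&` Omega) = 0%E)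
    (mu : {additive_charge set (borelType Omega) -> \bar R})
    (mu_dens : Dens F mu) :
  core mu `<=` F /\ pure mu.
Proof.
split; first exact: (core_Dens F_closed mu_dens).
exact: (pure_Dens F_closed F_null mu_dens).
Qed.
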